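(* In the calculus described in the context, for all terms $r,s$ and every type $A$: if $r\to s$ and $r:A$, then $s:A$, where $\to$ is either the reduction relation $\hookrightarrow$ or the symmetric relation $\rightleftarrows$.
   Context: Types are given by the grammar $A,B,C ::= X \mid A\Rightarrow B \mid A\wedge B \mid \forall X.A$. The relation $\equiv$ on types is the equivalence relation (compatible with the type constructors) generated by $A\wedge B\equiv B\wedge A$, $(A\wedge B)\wedge C\equiv A\wedge(B\wedge C)$, and $A\Rightarrow(B\wedge C)\equiv (A\Rightarrow B)\wedge(A\Rightarrow C)$. Terms (every variable occurrence carries a type) are given by $r,s,t ::= x^A \mid \lambda x^A.r \mid r\,s \mid r+s \mid \pi_A(r) \mid \Lambda X.r \mid r\{A\}$; the same variable name with different type annotations counts as a different variable, and terms and types are taken up to $\alpha$-conversion. $r[s/x]$ is capture-avoiding term substitution and $r[A/X]$ is capture-avoiding substitution of a type for a type variable throughout $r$ (including type annotations). If the free variables of $r$ are $x_1^{A_1},\dots,x_n^{A_n}$, write $\Gamma(r)=\{A_1,\dots,A_n\}$. Typing judgements $r:A$ are derived by the rules: $x^A:A$; from $r:A$ and $A\equiv B$ infer $r:B$; from $r:B$ infer $\lambda x^A.r:A\Rightarrow B$; from $r:A\Rightarrow B$ and $s:A$ infer $r\,s:B$; from $r:A$ and $s:B$ infer $r+s:A\wedge B$; from $r:A\wedge B$ infer $\pi_A(r):A$; from $r:A$ with $X$ not free in any type of $\Gamma(r)$ infer $\Lambda X.r:\forall X.A$; from $r:\forall X.A$ infer $r\{B\}:A[B/X]$. The symmetric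 relation $\rightleftarrows$ on terms is given by the following rules (each usable in both directions): $r+s\rightleftarrows s+r$; $(r+s)+t\rightleftarrows r+(s+t)$; $(r+s)\,t\rightleftarrows r\,t+s\,t$; $\lambda x^A.(r+s)\rightleftarrows \lambda x^A.r+\lambda x^A.s$; and, whenever $r:A\Rightarrow(B\wedge C)$, $\pi_{A\Rightarrow B}(r)\,s\rightleftarrows \pi_B(r\,s)$. The reduction relation $\hookrightarrow$ is given by the rules: $(\lambda x^A.r)\,s\hookrightarrow r[s/x]$; $(\Lambda X.r)\{A\}\hookrightarrow r[A/X]$; and, whenever $r:A$, $\pi_A(r+s)\hookrightarrow r$. *)

(* Defs.v *)
(* Stdlib, vanilla style.

   Alpha-conversion is made definitional by a locally nameless encoding: bound
   (type or term) variables are de Bruijn indices, free ones keep their name.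
   [type] and [term] are raw syntax; the types and terms of the calculus, up to
   alpha-conversion, are the raw ones without dangling index ([is_type],
   [is_term]).  The binders of the calculus are the operations [all_named],
   [lam_named] and [gen_named] below, which abstract a named variable, and every
   rule is written with them.  Every rule also requires its components to be
   genuine types and terms, so typing and both relations on terms hold of genuine
   types and terms only. *)
From Stdlib Require Import Arith List.

Inductive type : Set :=
| TVar (X : nat)
| TBound (k : nat)
| Arr (A B : type)
| And (A B : type)
| TAll (A : type).

Definition type_eq_dec (A B : type) : {A = B} + {A <> B}.
Proof. decide equality; apply Nat.eq_dec. Defined.

Fixpoint type_at (k : nat) (A : type) : Prop :=
  match A with
  | TVar _ => True
  | TBound i => i < k
  | Arr A B | And A B => type_at k A /\ type_at k B
  | TAll A => type_at (S k) A
  end.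

Definition is_type (A : type) : Prop := type_at 0 A.

Fixpoint free_in_type (X : nat) (A : type) : Prop :=
  match A with
  | TVar Y => X = Y
  | TBound _ => False
  | Arr A B | And A B => free_in_type X A \/ free_in_type X B
  | TAll A => free_in_type X A
  end.

Fixpoint close_type (k X : nat) (A : type) : type :=
  match A with
  | TVar Y => if Nat.eq_dec X Y then TBound k else TVar Y
  | TBound i => TBound i
  | Arr A B => Arr (close_type k X A) (close_type k X B)
  | And A B => And (close_type k X A) (close_type k X B)
  | TAll A => TAll (close_type (S k) X A)
  end.

(* ∀X.A *)
Definition all_named (X : nat) (A : type) : type := TAll (close_type 0 X A).

(* A[B/X]; no capture can occur when [B] is a genuine type, since bound
   variables have no name. *)
Fixpoint subst_type (X : nat) (B A : type) : type :=
  match A with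
  | TVar Y => if Nat.eq_dec X Y then B else TVar Y
  | TBound i => TBound i
  | Arr A1 A2 => Arr (subst_type X B A1) (subst_type X B A2)
  | And A1 A2 => And (subst_type X B A1) (subst_type X B A2)
  | TAll A1 => TAll (subst_type X B A1)
  end.

(* Bodies of quantifiers are compared as raw types, the index bound by the
   quantifier playing the role of a variable distinct from all others. *)
Inductive type_equiv : type -> type -> Prop :=
| equiv_refl A : type_equiv A A
| equiv_sym A B : type_equiv A B -> type_equiv B A
| equiv_trans A B C : type_equiv A B -> type_equiv B C -> type_equiv A C
| equiv_comm A B : type_equiv (And A B) (And B A)
| equiv_assoc A B C : type_equiv (And (And A B) C) (And A (And B C))
| equiv_dist A B C :
    type_equiv (Arr A (And B C)) (And (Arr A B) (Arr A C))
| equiv_arr A A' B B' :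
    type_equiv A A' -> type_equiv B B' -> type_equiv (Arr A B) (Arr A' B')
| equiv_and A A' B B' :
    type_equiv A A' -> type_equiv B B' -> type_equiv (And A B) (And A' B')
| equiv_all A A' : type_equiv A A' -> type_equiv (TAll A) (TAll A').

(* A free variable is a pair of a name and a type.  A bound occurrence carries
   no annotation of its own: it is necessarily the one of its binder, since
   [lam_named x A] captures only the occurrences of [x] annotated with [A]. *)
Inductive term : Set :=
| Var (x : nat) (A : type)
| Bound (k : nat)
| Lam (A : type) (r : term)
| App (r s : term)
| Plus (r s : term)
| Proj (A : type) (r : term)
| Gen (r : term)
| Inst (r : term) (A : type).

Fixpoint term_at (n k : nat) (r : term) : Prop :=
  match r with
  | Var _ A => type_at n A
  | Bound i => i < k
  | Lam A r => type_at n A /\ term_at n (S k) r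
  | App r s | Plus r s => term_at n k r /\ term_at n k s
  | Proj A r => type_at n A /\ term_at n k r
  | Gen r => term_at (S n) k r
  | Inst r A => term_at n k r /\ type_at n A
  end.

Definition is_term (r : term) : Prop := term_at 0 0 r.

Definition var_eq_dec (v w : nat * type) : {v = w} + {v <> w}.
Proof. decide equality; [apply type_eq_dec | apply Nat.eq_dec]. Defined.

Arguments var_eq_dec : simpl never.

Fixpoint close_term (k x : nat) (A : type) (r : term) : term :=
  match r with
  | Var y B => if var_eq_dec (x, A) (y, B) then Bound k else Var y B
  | Bound i => Bound i
  | Lam B r => Lam B (close_term (S k) x A r)
  | App r s => App (close_term k x A r) (close_term k x A s)
  | Plus r s => Plus (close_term k x A r) (close_term k x A s)
  | Proj B r => Proj B (close_term k x A r)
  | Gen r => Gen (close_term k x A r)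
  | Inst r B => Inst (close_term k x A r) B
  end.

(* λx^A.r *)
Definition lam_named (x : nat) (A : type) (r : term) : term :=
  Lam A (close_term 0 x A r).

Fixpoint close_type_in_term (k X : nat) (r : term) : term :=
  match r with
  | Var y B => Var y (close_type k X B)
  | Bound i => Bound i
  | Lam B r => Lam (close_type k X B) (close_type_in_term k X r)
  | App r s => App (close_type_in_term k X r) (close_type_in_term k X s)
  | Plus r s => Plus (close_type_in_term k X r) (close_type_in_term k X s)
  | Proj B r => Proj (close_type k X B) (close_type_in_term k X r)
  | Gen r => Gen (close_type_in_term (S k) X r)
  | Inst r B => Inst (close_type_in_term k X r) (close_type k X B)
  end.

(* ΛX.r *)
Definition gen_named (X : nat) (r : term) : term :=
  Gen (close_type_in_term 0 X r).

(* r[s/x] for the variable x^A. *)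
Fixpoint subst_term (x : nat) (A : type) (s r : term) : term :=
  match r with
  | Var y B => if var_eq_dec (x, A) (y, B) then s else Var y B
  | Bound i => Bound i
  | Lam B r => Lam B (subst_term x A s r)
  | App r t => App (subst_term x A s r) (subst_term x A s t)
  | Plus r t => Plus (subst_term x A s r) (subst_term x A s t)
  | Proj B r => Proj B (subst_term x A s r)
  | Gen r => Gen (subst_term x A s r)
  | Inst r B => Inst (subst_term x A s r) B
  end.

(* r[A/X] *)
Fixpoint subst_type_in_term (X : nat) (A : type) (r : term) : term :=
  match r with
  | Var y B => Var y (subst_type X A B)
  | Bound i => Bound i
  | Lam B r => Lam (subst_type X A B) (subst_type_in_term X A r)
  | App r s => App (subst_type_in_term X A r) (subst_type_in_term X A s)
  | Plus r s => Plus (subst_type_in_term X A r) (subst_type_in_term X A s)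
  | Proj B r => Proj (subst_type X A B) (subst_type_in_term X A r)
  | Gen r => Gen (subst_type_in_term X A r)
  | Inst r B => Inst (subst_type_in_term X A r) (subst_type X A B)
  end.

Fixpoint free_vars (r : term) : list (nat * type) :=
  match r with
  | Var x A => (x, A) :: nil
  | Bound _ => nil
  | Lam _ r | Proj _ r | Gen r | Inst r _ => free_vars r
  | App r s | Plus r s => free_vars r ++ free_vars s
  end.

(* Γ(r) *)
Definition Gamma (r : term) : list type := map snd (free_vars r).

Inductive typed : term -> type -> Prop :=
| typed_var x A : is_type A -> typed (Var x A) A
| typed_equiv r A B : typed r A -> type_equiv A B -> typed r B
| typed_lam x A r B :
    is_type A -> typed r B -> typed (lam_named x A r) (Arr A B)
| typed_app r s A B :
    typed r (Arr A B) -> typed s A -> typed (App r s) B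
| typed_plus r s A B :
    typed r A -> typed s B -> typed (Plus r s) (And A B)
| typed_proj r A B : typed r (And A B) -> typed (Proj A r) A
| typed_gen X r A :
    typed r A ->
    (forall B, In B (Gamma r) -> ~ free_in_type X B) ->
    typed (gen_named X r) (all_named X A)
| typed_inst X r A B :
    is_type A -> is_type B ->
    typed r (all_named X A) -> typed (Inst r B) (subst_type X B A).

(* The rules of ⇄, read from left to right. *)
Inductive sym_rule : term -> term -> Prop :=
| sym_comm r s :
    is_term r -> is_term s -> sym_rule (Plus r s) (Plus s r)
| sym_assoc r s t :
    is_term r -> is_term s -> is_term t ->
    sym_rule (Plus (Plus r s) t) (Plus r (Plus s t))
| sym_app r s t :
    is_term r -> is_term s -> is_term t ->
    sym_rule (App (Plus r s) t) (Plus (App r t) (App s t))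
| sym_lam x A r s :
    is_type A -> is_term r -> is_term s ->
    sym_rule (lam_named x A (Plus r s))
             (Plus (lam_named x A r) (lam_named x A s))
| sym_proj r s A B C :
    typed r (Arr A (And B C)) -> is_term s ->
    sym_rule (App (Proj (Arr A B) r) s) (Proj B (App r s)).

Definition sym_rule2 (r s : term) : Prop := sym_rule r s \/ sym_rule s r.

Inductive red_rule : term -> term -> Prop :=
| red_beta x A r s :
    is_type A -> is_term r -> is_term s ->
    red_rule (App (lam_named x A r) s) (subst_term x A s r)
| red_type_beta X r A :
    is_term r -> is_type A ->
    red_rule (Inst (gen_named X r) A) (subst_type_in_term X A r)
| red_proj r s A :
    typed r A -> is_term s -> red_rule (Proj A (Plus r s)) r.

(* As usual for rewrite rules, the rules may be applied at any position. *)
Inductive contextual (R : term -> term -> Prop) : term -> term -> Prop :=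
| ctx_rule r s : R r s -> contextual R r s
| ctx_lam x A r s :
    is_type A -> contextual R r s ->
    contextual R (lam_named x A r) (lam_named x A s)
| ctx_app_l r s t :
    is_term t -> contextual R r s -> contextual R (App r t) (App s t)
| ctx_app_r r s t :
    is_term t -> contextual R r s -> contextual R (App t r) (App t s)
| ctx_plus_l r s t :
    is_term t -> contextual R r s -> contextual R (Plus r t) (Plus s t)
| ctx_plus_r r s t :
    is_term t -> contextual R r s -> contextual R (Plus t r) (Plus t s)
| ctx_proj A r s :
    is_type A -> contextual R r s -> contextual R (Proj A r) (Proj A s)
| ctx_gen X r s :
    contextual R r s -> contextual R (gen_named X r) (gen_named X s)
| ctx_inst A r s :
    is_type A -> contextual R r s -> contextual R (Inst r A) (Inst s A).

(* ⇄ *)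
Definition sym : term -> term -> Prop := contextual sym_rule2.

(* ↪ *)
Definition red : term -> term -> Prop := contextual red_rule.

(* Main.v *)
(* Typing is recast as a judgement on raw locally nameless terms, in which a
   bound term variable gets its type from a context and a type abstraction
   shifts that context; free variables are annotated with closed types, which is
   what the side condition on ΛX.r amounts to.  Choices of bound names disappear
   from this judgement.  Up to ≡, a type is the multiset of its prime factors
   (those of A⇒B being A⇒P for P a prime factor of B); so ⇒ and ∀ are injective
   up to ≡, a conjunction equivalent to D⇒T splits T, and the type of a term is
   unique up to ≡.  The rules then preserve typing by inversion, and they create
   no free variable, as needed to reduce under ΛX. *)
From Stdlib Require Import Arith List Lia SetoidList SetoidPermutation.
Require Import Defs.
Import ListNotations.

(** * Type equivalence *)

(** Only the spine made of conjunctions and codomains is decomposed. The domain of an arrow and the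
    body of a quantifier are kept as they are, since [prime_equiv] compares them up to
    [type_equiv]. *)
Fixpoint primes (A : type) : list type :=
  match A with
  | And A B => primes A ++ primes B
  | Arr A B => map (Arr A) (primes B)
  | _ => [A]
  end.

(* The value on the empty list is junk: [primes] is never empty. *)
Fixpoint big_and (l : list type) : type :=
  match l with
  | [] => TBound 0
  | [A] => A
  | A :: l => And A (big_and l)
  end.

Definition prime_equiv (P Q : type) : Prop :=
  match P, Q with
  | Arr A B, Arr A' B' => type_equiv A A' /\ type_equiv B B'
  | TAll A, TAll A' => type_equiv A A'
  | _, _ => P = Q
  end.

(** Returning [P] itself off arrows makes this respect [prime_equiv] on all factors. *)
Definition codomain (P : type) : type :=
  match P with Arr _ B => B | _ => P end.

#[local] Instance type_equiv_equivalence : Equivalence type_equiv.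
Proof.
  split; [exact equiv_refl | exact equiv_sym | exact equiv_trans].
Qed.

#[local] Instance And_proper :
  Proper (type_equiv ==> type_equiv ==> type_equiv) And.
Proof. intros A A' HA B B' HB. now apply equiv_and. Qed.

#[local] Instance Arr_proper :
  Proper (type_equiv ==> type_equiv ==> type_equiv) Arr.
Proof. intros A A' HA B B' HB. now apply equiv_arr. Qed.

#[local] Instance prime_equiv_equivalence : Equivalence prime_equiv.
Proof.
  split.
  - intros []; simpl; auto; [split|]; reflexivity.
  - intros [] []; simpl; try congruence; [intros [? ?]; split|]; now symmetry.
  - intros [] [] []; simpl; try congruence;
      [intros [? ?] [? ?]; split | intros ? ?]; etransitivity; eassumption.
Qed.

Lemma prime_equiv_type_equiv P Q : prime_equiv P Q -> type_equiv P Q.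
Proof.
  destruct P, Q; simpl; try (intros H; rewrite H; reflexivity);
    try discriminate.
  - intros [? ?]. now apply equiv_arr.
  - apply equiv_all.
Qed.

Lemma codomain_equiv P Q :
  prime_equiv P Q -> type_equiv (codomain P) (codomain Q).
Proof.
  intros H. destruct P, Q; simpl in *; try discriminate;
    try (rewrite H; reflexivity).
  - tauto.
  - now apply equiv_all.
Qed.

Lemma primes_neq_nil A : primes A <> [].
Proof.
  induction A; simpl; try discriminate.
  - intros H. now apply map_eq_nil in H.
  - intros H. now apply app_eq_nil in H as [? _].
Qed.

(** Two functions are allowed because the factors of [Arr A B] and [Arr A' B'] come from mapping
    [Arr A] and [Arr A'], where the domains are equivalent but may differ. *)
Lemma PermutationA_map {S T : Type} (eqS : S -> S -> Prop)
    (eqT : T -> T -> Prop) (f g : S -> T) l m :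
  Equivalence eqT -> Equivalence eqS ->
  (forall x y, eqS x y -> eqT (f x) (g y)) ->
  PermutationA eqS l m -> PermutationA eqT (map f l) (map g m).
Proof.
  intros ET ES Hfg H.
  transitivity (map g l).
  - clear H. induction l; simpl; constructor; auto. apply Hfg. reflexivity.
  - assert (Hg : forall x y, eqS x y -> eqT (g x) (g y)).
    { intros x y E. transitivity (f x); [symmetry|]; apply Hfg; auto.
      reflexivity. }
    induction H; simpl; [| | |etransitivity; eassumption];
      auto using permA_nil, permA_skip, permA_swap.
Qed.

(** Each axiom of the equivalence is a fact about lists: commutativity swaps two blocks,
    associativity is that of concatenation, and distributivity says that [map] commutes with
    concatenation. *)
Lemma type_equiv_primes A B :
  type_equiv A B -> PermutationA prime_equiv (primes A) (primes B).
Proof.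
  induction 1; simpl.
  - reflexivity.
  - now symmetry.
  - etransitivity; eassumption.
  - apply PermutationA_app_comm. typeclasses eauto.
  - rewrite app_assoc. reflexivity.
  - rewrite map_app. reflexivity.
  - apply (PermutationA_map prime_equiv); try typeclasses eauto; auto.
    simpl. auto using prime_equiv_type_equiv.
  - apply PermutationA_app; auto. typeclasses eauto.
  - constructor; [assumption | constructor].
Qed.

Lemma big_and_cons A l : l <> [] -> big_and (A :: l) = And A (big_and l).
Proof. now destruct l. Qed.

Lemma big_and_app l m :
  l <> [] -> m <> [] -> type_equiv (big_and (l ++ m)) (And (big_and l) (big_and m)).
Proof.
  intros Hl Hm. induction l as [|A l IH]; [easy|].
  destruct l as [|B l].
  - simpl app. rewrite big_and_cons by assumption. reflexivity.
  - change ((A :: B :: l) ++ m) with (A :: ((B :: l) ++ m)).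
    rewrite !big_and_cons by easy. rewrite IH by easy.
    now rewrite equiv_assoc.
Qed.

Lemma PermutationA_nil {S : Type} (eqS : S -> S -> Prop) m :
  PermutationA eqS [] m -> m = [].
Proof.
  intros H. remember [] as l eqn:E. induction H; try discriminate.
  - reflexivity.
  - specialize (IHPermutationA1 E).
    rewrite IHPermutationA2; congruence.
Qed.

Lemma big_and_perm l m :
  PermutationA type_equiv l m -> type_equiv (big_and l) (big_and m).
Proof.
  induction 1 as [|A B l m E H IH|A B l|]; [reflexivity| | |].
  - destruct l as [|C l], m as [|D m].
    + assumption.
    + now apply PermutationA_nil in H.
    + symmetry in H. now apply PermutationA_nil in H.
    + rewrite !big_and_cons by easy. now apply equiv_and.
  - destruct l; [apply equiv_comm|].
    rewrite !big_and_cons by easy.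
    rewrite <- equiv_assoc, (equiv_comm B A). apply equiv_assoc.
  - etransitivity; eassumption.
Qed.

Lemma big_and_map_Arr A l :
  l <> [] -> type_equiv (big_and (map (Arr A) l)) (Arr A (big_and l)).
Proof.
  intros Hl. induction l as [|B l IH]; [easy|].
  destruct l as [|C l]; [reflexivity|].
  simpl map. rewrite !big_and_cons by easy. simpl map in IH.
  rewrite IH by easy. symmetry. apply equiv_dist.
Qed.

Lemma big_and_primes A : type_equiv (big_and (primes A)) A.
Proof.
  induction A; simpl; try reflexivity.
  - rewrite big_and_map_Arr by apply primes_neq_nil. now rewrite IHA2.
  - rewrite big_and_app by apply primes_neq_nil. now rewrite IHA1, IHA2.
Qed.

Lemma map_codomain_Arr A l : map codomain (map (Arr A) l) = l.
Proof. rewrite map_map. apply map_id. Qed.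

Lemma PermutationA_in {S : Type} (eqS : S -> S -> Prop) l m x :
  Equivalence eqS -> PermutationA eqS l m -> In x l ->
  exists y, In y m /\ eqS x y.
Proof.
  intros E H Hx.
  apply PermutationA_equivlistA in H; [|assumption].
  destruct (proj1 (InA_alt eqS x m)) as (y & ? & ?); [|now exists y].
  apply H. apply In_InA; assumption.
Qed.

(** The factors of [Arr D T] are all arrows from [D], and a factor matched with an arrow is itself
    an arrow with an equivalent domain. *)
Lemma prime_of_Arr A D T P :
  type_equiv A (Arr D T) -> In P (primes A) ->
  type_equiv P (Arr D (codomain P)).
Proof.
  intros H HP. apply type_equiv_primes in H.
  destruct (PermutationA_in _ _ _ _ _ H HP) as (Q & HQ & E).
  simpl in HQ. apply in_map_iff in HQ as (Q' & <- & _).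
  destruct P; try discriminate. simpl in *. destruct E as [E _].
  now rewrite E.
Qed.

(** By the matching of factors, every factor of [A] and of [B] is an arrow from [D], so [T1] and
    [T2] can be taken as the conjunctions of the codomains of these factors. *)
Lemma And_equiv_Arr A B D T :
  type_equiv (And A B) (Arr D T) ->
  exists T1 T2, type_equiv T (And T1 T2) /\
    type_equiv A (Arr D T1) /\ type_equiv B (Arr D T2).
Proof.
  intros H.
  (* The common domain [D] is pulled out of the conjunction of the factors. *)
  assert (Hcod : forall C, (forall P, In P (primes C) ->
      type_equiv P (Arr D (codomain P))) ->
      type_equiv C (Arr D (big_and (map codomain (primes C))))).
  { intros C HC.
    rewrite <- big_and_map_Arr
      by (intros E; apply map_eq_nil in E; now apply primes_neq_nil in E).
    rewrite <- (big_and_primes C) at 1. apply big_and_perm. rewrite map_map.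
    induction (primes C); simpl; constructor.
    - apply HC. now left.
    - apply IHl. intros P HP. apply HC. now right. }
  exists (big_and (map codomain (primes A))), (big_and (map codomain (primes B))).
  split; [|split; apply Hcod; intros P HP; apply (prime_of_Arr _ _ _ _ H);
    simpl; apply in_app_iff; auto].
  rewrite <- big_and_app, <- map_app
    by (intros E; apply map_eq_nil in E; now apply primes_neq_nil in E).
  (* The factors of [T] are viewed as the codomains of those of [Arr D T], which match the factors
     of [And A B]. *)
  rewrite <- (big_and_primes T) at 1.
  rewrite <- (map_codomain_Arr D (primes T)).
  apply big_and_perm, (PermutationA_map prime_equiv); try typeclasses eauto.
  - exact codomain_equiv.
  - symmetry. exact (type_equiv_primes _ _ H).
Qed.

(** Any single factor reveals the domain, and one exists since factor lists are nonempty. Taking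
    codomains throughout the permutation matches the factors of [B] with those of [B']. *)
Lemma Arr_inj A B A' B' :
  type_equiv (Arr A B) (Arr A' B') -> type_equiv A A' /\ type_equiv B B'.
Proof.
  intros H. apply type_equiv_primes in H. simpl in H. split.
  - destruct (primes B) as [|P l] eqn:E; [now apply primes_neq_nil in E|].
    destruct (PermutationA_in _ _ _ (Arr A P) _ H) as (Q & HQ & EQ);
      [now left|].
    apply in_map_iff in HQ as (Q' & <- & _). apply EQ.
  - apply (PermutationA_map _ type_equiv codomain codomain) in H;
      try typeclasses eauto; [|exact codomain_equiv].
    rewrite !map_codomain_Arr in H. apply big_and_perm in H.
    now rewrite !big_and_primes in H.
Qed.

Lemma TAll_inj A A' : type_equiv (TAll A) (TAll A') -> type_equiv A A'.
Proof.
  intros H. apply type_equiv_primes in H.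
  destruct (PermutationA_in _ _ _ (TAll A) _ H) as (Q & HQ & EQ);
    [now left|].
  destruct HQ as [<-|[]]. exact EQ.
Qed.

Lemma type_equiv_at A B : type_equiv A B -> forall k, type_at k A <-> type_at k B.
Proof.
  induction 1; intros k; simpl; try tauto.
  - now symmetry.
  - now rewrite IHtype_equiv1.
  - now rewrite IHtype_equiv1, IHtype_equiv2.
  - now rewrite IHtype_equiv1, IHtype_equiv2.
  - apply IHtype_equiv.
Qed.

(** * Shifting and instantiating indices *)

Fixpoint lift (c : nat) (A : type) : type :=
  match A with
  | TVar X => TVar X
  | TBound i => TBound (if i <? c then i else S i)
  | Arr A B => Arr (lift c A) (lift c B)
  | And A B => And (lift c A) (lift c B)
  | TAll A => TAll (lift (S c) A)
  end.

(* Replaces the index [k] by [C] and lowers the indices above [k]. *)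
Fixpoint tinst (k : nat) (C A : type) : type :=
  match A with
  | TVar X => TVar X
  | TBound i =>
      match Nat.compare i k with
      | Lt => TBound i
      | Eq => C
      | Gt => TBound (pred i)
      end
  | Arr A B => Arr (tinst k C A) (tinst k C B)
  | And A B => And (tinst k C A) (tinst k C B)
  | TAll A => TAll (tinst (S k) (lift 0 C) A)
  end.

(* [C] is meant to be a genuine type: it is not lifted under [Gen]. *)
Fixpoint inst_type (k : nat) (C : type) (r : term) : term :=
  match r with
  | Var x A => Var x (tinst k C A)
  | Bound i => Bound i
  | Lam A r => Lam (tinst k C A) (inst_type k C r)
  | App r s => App (inst_type k C r) (inst_type k C s)
  | Plus r s => Plus (inst_type k C r) (inst_type k C s)
  | Proj A r => Proj (tinst k C A) (inst_type k C r)
  | Gen r => Gen (inst_type (S k) C r)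
  | Inst r A => Inst (inst_type k C r) (tinst k C A)
  end.

(* [s] is meant to be a genuine term, and [k] the largest index: nothing is
   lifted or lowered. *)
Fixpoint inst_term (k : nat) (s r : term) : term :=
  match r with
  | Var x A => Var x A
  | Bound i => if i =? k then s else Bound i
  | Lam A r => Lam A (inst_term (S k) s r)
  | App r t => App (inst_term k s r) (inst_term k s t)
  | Plus r t => Plus (inst_term k s r) (inst_term k s t)
  | Proj A r => Proj A (inst_term k s r)
  | Gen r => Gen (inst_term k s r)
  | Inst r A => Inst (inst_term k s r) A
  end.

Ltac step :=
  cbn [lift tinst close_type subst_type type_at free_in_type].

Ltac cases_index :=
  repeat match goal with
  | |- context [?i <? ?j] => destruct (Nat.ltb_spec i j); step
  | |- context [Nat.compare ?i ?j] => destruct (Nat.compare_spec i j); step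
  | |- context [Nat.eqb ?i ?j] => destruct (Nat.eqb_spec i j); step
  | |- context [Nat.eq_dec ?i ?j] => destruct (Nat.eq_dec i j); step
  end.

Lemma type_at_le k l A : type_at k A -> k <= l -> type_at l A.
Proof.
  revert k l. induction A; simpl; intros m l H Hl; auto.
  - lia.
  - destruct H; eauto.
  - destruct H; eauto.
  - apply (IHA (S m)); auto. lia.
Qed.

Lemma lift_type_at k c A : type_at k A -> k <= c -> lift c A = A.
Proof.
  revert k c. induction A; simpl; intros m c H Hc; auto.
  - cases_index; f_equal; lia.
  - destruct H. f_equal; eauto.
  - destruct H. f_equal; eauto.
  - f_equal. apply (IHA (S m)); auto. lia.
Qed.

Lemma tinst_type_at k j C A : type_at k A -> k <= j -> tinst j C A = A.
Proof.
  revert k j C. induction A; simpl; intros m j C H Hj; auto.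
  - cases_index; f_equal; lia.
  - destruct H. f_equal; eauto.
  - destruct H. f_equal; eauto.
  - f_equal. apply (IHA (S m)); auto. lia.
Qed.

Lemma lift_is_type c A : is_type A -> lift c A = A.
Proof. intros H. apply (lift_type_at 0); [assumption | lia]. Qed.

Lemma tinst_is_type k C A : is_type A -> tinst k C A = A.
Proof. intros H. apply (tinst_type_at 0); [assumption | lia]. Qed.

Lemma lift_at k c A : type_at k A -> type_at (S k) (lift c A).
Proof.
  revert k c. induction A; simpl; intros m c H; auto.
  - cases_index; lia.
  - destruct H; auto.
  - destruct H; auto.
Qed.

Lemma tinst_at j k C A :
  j <= k -> type_at (S k) A -> type_at k C -> type_at k (tinst j C A).
Proof.
  revert j k C. induction A; simpl; intros j m C Hj H HC; auto.
  - cases_index; auto; lia.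
  - destruct H; auto.
  - destruct H; auto.
  - apply IHA; auto using lift_at. lia.
Qed.

Lemma tinst_equiv k C A B :
  type_equiv A B -> type_equiv (tinst k C A) (tinst k C B).
Proof.
  intros H. revert k C.
  induction H; intros k D; simpl; eauto using type_equiv.
Qed.

Lemma close_type_equiv k X A B :
  type_equiv A B -> type_equiv (close_type k X A) (close_type k X B).
Proof.
  intros H. revert k.
  induction H; intros k; simpl; eauto using type_equiv.
Qed.

(** The position is written [c + k] so that the induction can raise [c] under a quantifier while [k]
    stays fixed; the commutations below use the same device. *)
Lemma lift_tinst c k C A :
  is_type C ->
  lift c (tinst (c + k) C A) = tinst (S (c + k)) C (lift c A).
Proof.
  intros HC. revert c.
  induction A; intros c; cbn [lift tinst]; auto;
    try (f_equal; solve [auto]).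
  - cases_index; try lia; try (f_equal; lia). now rewrite lift_is_type.
  - f_equal. rewrite (lift_is_type 0 C) by assumption. apply (IHA (S c)).
Qed.

Lemma tinst_tinst j k C B A :
  is_type C ->
  tinst (j + k) C (tinst j B A) =
  tinst j (tinst (j + k) C B) (tinst (S (j + k)) C A).
Proof.
  intros HC. revert j B.
  induction A; intros j B; cbn [tinst]; auto;
    try (f_equal; solve [auto]).
  - cases_index; try lia; try reflexivity; try (f_equal; lia).
    now rewrite tinst_is_type.
  - f_equal. rewrite (lift_is_type _ C) by assumption. rewrite (IHA (S j)).
    simpl Nat.add. f_equal.
    symmetry. now apply (lift_tinst 0).
Qed.

(** * Abstracting names and opening binders *)

Lemma close_type_at k X A : type_at k A -> type_at (S k) (close_type k X A).
Proof.
  revert k. induction A; simpl; intros m H; auto.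
  - cases_index; auto.
  - destruct H; auto.
  - destruct H; auto.
Qed.

Lemma close_type_fresh k X A : ~ free_in_type X A -> close_type k X A = A.
Proof.
  revert k. induction A; simpl; intros m H; f_equal; auto.
  now cases_index.
Qed.

(** A free occurrence of [X] would become the index [k], which dangles at level [n]. *)
Lemma close_type_not_free n k X A :
  type_at n (close_type k X A) -> n <= k -> ~ free_in_type X A.
Proof.
  revert n k. induction A; simpl; intros n m H Hn.
  - destruct (Nat.eq_dec X X0); simpl in H; [lia | assumption].
  - auto.
  - destruct H. intros [|]; [eapply IHA1 | eapply IHA2]; eauto.
  - destruct H. intros [|]; [eapply IHA1 | eapply IHA2]; eauto.
  - apply (IHA _ _ H). lia.
Qed.

Lemma lift_close_type c k X A :
  lift c (close_type (c + k) X A) = close_type (S (c + k)) X (lift c A).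
Proof.
  revert c. induction A; intros c; cbn [lift close_type]; auto;
    try (f_equal; solve [auto]).
  - cases_index; auto. cases_index; auto; lia.
Qed.

Lemma close_type_tinst j k X B A :
  close_type (j + k) X (tinst j B A) =
  tinst j (close_type (j + k) X B) (close_type (S (j + k)) X A).
Proof.
  revert j B. induction A; intros j B; cbn [close_type tinst]; auto;
    try (f_equal; solve [auto]).
  - cases_index; auto; lia.
  - cases_index; auto.
  - f_equal. rewrite (IHA (S j)). f_equal. symmetry. apply (lift_close_type 0).
Qed.

Lemma tinst_close_type k X B A :
  type_at k A -> is_type B -> tinst k B (close_type k X A) = subst_type X B A.
Proof.
  intros H HB. revert k H. induction A; simpl; intros m H; auto.
  - cases_index; auto; lia.
  - cases_index; auto; lia.
  - destruct H. f_equal; auto.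
  - destruct H. f_equal; auto.
  - rewrite lift_is_type by assumption. f_equal. auto.
Qed.

Lemma subst_type_self X A : subst_type X (TVar X) A = A.
Proof. induction A; simpl; f_equal; auto. cases_index; congruence. Qed.

(** Freshness is expressed by a bound beyond which every name will do, so one name can be made fresh
    for several objects by taking a maximum. *)
Lemma close_type_tinst_fresh A :
  exists N, forall X k, N <= X -> type_at (S k) A ->
  close_type k X (tinst k (TVar X) A) = A.
Proof.
  induction A; simpl.
  - exists (S X). intros Y k HY _. cases_index; [lia | reflexivity].
  - exists 0. intros X j _ H. cases_index; auto; lia.
  - destruct IHA1 as [N1 H1], IHA2 as [N2 H2].
    exists (max N1 N2). intros X k HX []. f_equal; [apply H1 | apply H2];
      auto; lia.
  - destruct IHA1 as [N1 H1], IHA2 as [N2 H2].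
    exists (max N1 N2). intros X k HX []. f_equal; [apply H1 | apply H2];
      auto; lia.
  - destruct IHA as [N H1]. exists N. intros X k HX H. f_equal. auto.
Qed.

Lemma close_inst_type_fresh r :
  exists N, forall X n k, N <= X -> term_at (S k) n r ->
  close_type_in_term k X (inst_type k (TVar X) r) = r.
Proof.
  induction r; simpl;
    repeat match goal with H : exists _, _ |- _ => destruct H as [? ?] end;
    try (destruct (close_type_tinst_fresh A) as [NA HA]).
  - exists NA. intros. f_equal. auto.
  - now exists 0.
  - exists (max x NA). intros X n k HX [].
    f_equal; [apply HA | eapply H]; eauto; lia.
  - exists (max x x0). intros X n k HX [].
    f_equal; [eapply H0 | eapply H]; eauto; lia.
  - exists (max x x0). intros X n k HX [].
    f_equal; [eapply H0 | eapply H]; eauto; lia.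
  - exists (max x NA). intros X n k HX [].
    f_equal; [apply HA | eapply H]; eauto; lia.
  - exists x. intros. f_equal. eauto.
  - exists (max x NA). intros X n k HX [].
    f_equal; [eapply H | apply HA]; eauto; lia.
Qed.

Lemma close_inst_term_fresh A r :
  exists N, forall x n k, N <= x -> term_at n (S k) r ->
  close_term k x A (inst_term k (Var x A) r) = r.
Proof.
  induction r; simpl;
    repeat match goal with H : exists _, _ |- _ => destruct H as [? ?] end.
  - exists (S x). intros y n k Hy _.
    destruct var_eq_dec as [E|]; [|reflexivity].
    injection E as -> ->. lia.
  - exists 0. intros y n j _ H. cases_index; [|reflexivity].
    simpl. destruct var_eq_dec; congruence.
  - exists x. intros y n k Hy []. f_equal. eauto.
  - exists (max x x0). intros y n k Hy [].
    f_equal; [eapply H0 | eapply H]; eauto; lia.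
  - exists (max x x0). intros y n k Hy [].
    f_equal; [eapply H0 | eapply H]; eauto; lia.
  - exists x. intros y n k Hy []. f_equal. eauto.
  - exists x. intros. f_equal. eauto.
  - exists x. intros y n k Hy []. f_equal. eauto.
Qed.

(** This turns the named reduction of type abstractions into instantiation of an index. The level
    hypothesis ensures that the only index [k] in the closed term comes from [X]. *)
Lemma inst_type_close k n X C r :
  term_at k n r -> is_type C ->
  inst_type k C (close_type_in_term k X r) = subst_type_in_term X C r.
Proof.
  intros H HC. revert k n H.
  induction r; simpl; intros m n H; f_equal;
    repeat match goal with H : _ /\ _ |- _ => destruct H end;
    eauto using tinst_close_type.
Qed.

Lemma inst_term_close n k x A s r :
  term_at n k r -> inst_term k s (close_term k x A r) = subst_term x A s r.
Proof.
  revert n k. induction r; simpl; intros n m H;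
    repeat match goal with H : _ /\ _ |- _ => destruct H end;
    try (f_equal; eauto; fail).
  - destruct var_eq_dec; simpl; [now rewrite Nat.eqb_refl | reflexivity].
  - cases_index; [lia | reflexivity].
Qed.

(** Opening a binder with the very name it abstracted is such a substitution, so the original body
    comes back without any choice of fresh name. *)
Lemma subst_type_in_term_self X r : subst_type_in_term X (TVar X) r = r.
Proof. induction r; simpl; f_equal; auto using subst_type_self. Qed.

Lemma subst_term_self x A r : subst_term x A (Var x A) r = r.
Proof.
  induction r; simpl; f_equal; auto.
  destruct var_eq_dec; congruence.
Qed.

Lemma close_term_at n k x A r :
  term_at n k r -> term_at n (S k) (close_term k x A r).
Proof.
  revert n k. induction r; simpl; intros n m H;
    repeat match goal with H : _ /\ _ |- _ => destruct H end; auto.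
  destruct var_eq_dec; simpl; auto.
Qed.

Lemma close_type_in_term_at k n X r :
  term_at k n r -> term_at (S k) n (close_type_in_term k X r).
Proof.
  revert k n. induction r; simpl; intros m n H;
    repeat match goal with H : _ /\ _ |- _ => destruct H end;
    auto using close_type_at.
Qed.

Lemma lam_named_is_term x A r :
  is_type A -> is_term r -> is_term (lam_named x A r).
Proof. split; [assumption | now apply close_term_at]. Qed.

Lemma gen_named_is_term X r : is_term r -> is_term (gen_named X r).
Proof. apply close_type_in_term_at. Qed.

(** * Typing raw terms *)

(* [D] gives the types of the term indices; [k] type indices are in scope. *)
Inductive db_typed : nat -> list type -> term -> type -> Prop :=
| db_var k D x A : is_type A -> db_typed k D (Var x A) A
| db_bound k D i A : nth_error D i = Some A -> db_typed k D (Bound i) A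
| db_equiv k D r A B :
    db_typed k D r A -> type_equiv A B -> db_typed k D r B
| db_lam k D A r B :
    type_at k A -> db_typed k (A :: D) r B -> db_typed k D (Lam A r) (Arr A B)
| db_app k D r s A B :
    db_typed k D r (Arr A B) -> db_typed k D s A -> db_typed k D (App r s) B
| db_plus k D r s A B :
    db_typed k D r A -> db_typed k D s B -> db_typed k D (Plus r s) (And A B)
| db_proj k D r A B : db_typed k D r (And A B) -> db_typed k D (Proj A r) A
| db_gen k D r A :
    db_typed (S k) (map (lift 0) D) r A -> db_typed k D (Gen r) (TAll A)
| db_inst k D r A B :
    type_at k B -> db_typed k D r (TAll A) ->
    db_typed k D (Inst r B) (tinst 0 B A).

(** Conversion can end any derivation, so successive conversions are merged into one equivalence.
    For an application the conversion is pushed into the codomain of the function instead. *)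
Lemma db_typed_inv k D r T :
  db_typed k D r T ->
  match r with
  | Var _ A => is_type A /\ type_equiv A T
  | Bound i => exists A, nth_error D i = Some A /\ type_equiv A T
  | Lam A r => exists B,
      type_at k A /\ db_typed k (A :: D) r B /\ type_equiv (Arr A B) T
  | App r s => exists A, db_typed k D r (Arr A T) /\ db_typed k D s A
  | Plus r s => exists A B,
      db_typed k D r A /\ db_typed k D s B /\ type_equiv (And A B) T
  | Proj A r => exists B, db_typed k D r (And A B) /\ type_equiv A T
  | Gen r => exists A,
      db_typed (S k) (map (lift 0) D) r A /\ type_equiv (TAll A) T
  | Inst r B => exists A, type_at k B /\
      db_typed k D r (TAll A) /\ type_equiv (tinst 0 B A) T
  end.
Proof.
  induction 1; eauto 7 using equiv_refl.
  destruct r;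
    repeat match goal with
    | H : exists _, _ |- _ => destruct H
    | H : _ /\ _ |- _ => destruct H
    end; eauto 9 using equiv_trans, equiv_arr, equiv_refl, db_equiv.
Qed.

(** Injectivity of the arrow settles applications and injectivity of the quantifier settles
    instantiations; in the other cases the equivalence is compatible with the constructor or the
    type is read off the term or the context. *)
Lemma db_typed_unique r :
  forall k D A B, db_typed k D r A -> db_typed k D r B -> type_equiv A B.
Proof.
  induction r; intros m D T1 T2 H1 H2;
    apply db_typed_inv in H1; apply db_typed_inv in H2;
    repeat match goal with
    | H : exists _, _ |- _ => destruct H
    | H : _ /\ _ |- _ => destruct H
    end.
  - now transitivity A; [symmetry|].
  - transitivity x; [|assumption]. symmetry. congruence.
  - transitivity (Arr A x0); [now symmetry|].
    transitivity (Arr A x); [|assumption]. apply equiv_arr; eauto. reflexivity.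
  - eapply Arr_inj; eauto.
  - transitivity (And x1 x2); [now symmetry|].
    transitivity (And x x0); [|assumption]. apply equiv_and; eauto.
  - now transitivity A; [symmetry|].
  - transitivity (TAll x0); [now symmetry|].
    transitivity (TAll x); [|assumption]. apply equiv_all; eauto.
  - transitivity (tinst 0 A x0); [now symmetry|].
    transitivity (tinst 0 A x); [|assumption].
    apply tinst_equiv, TAll_inj; eauto.
Qed.

Lemma Forall_lift k D :
  Forall (type_at k) D -> Forall (type_at (S k)) (map (lift 0) D).
Proof. induction 1; simpl; constructor; auto using lift_at. Qed.

Lemma db_typed_at k D r A :
  db_typed k D r A -> Forall (type_at k) D ->
  term_at k (length D) r /\ type_at k A.
Proof.
  induction 1; simpl; intros HD.
  - split; apply (type_at_le 0); auto; lia.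
  - split; [apply nth_error_Some; congruence|].
    rewrite Forall_forall in HD. apply HD. eapply nth_error_In; eauto.
  - destruct IHdb_typed; auto. split; auto. eapply type_equiv_at; eauto.
    now symmetry.
  - destruct IHdb_typed; auto.
  - destruct IHdb_typed1 as [? []], IHdb_typed2; auto.
  - destruct IHdb_typed1, IHdb_typed2; auto.
  - destruct IHdb_typed as [? []]; auto.
  - destruct IHdb_typed as [HT HA]; auto using Forall_lift.
    now rewrite length_map in HT.
  - destruct IHdb_typed as [HT HA]; auto. split; auto.
    apply tinst_at; auto. lia.
Qed.

Lemma db_typed_is_type r A : db_typed 0 [] r A -> is_type A.
Proof. intros H. now apply db_typed_at in H. Qed.

Lemma db_typed_is_term r A : db_typed 0 [] r A -> is_term r.
Proof. intros H. now apply db_typed_at in H. Qed.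

(** * Substitution and abstraction in raw judgements *)

Lemma db_typed_weaken k D r A :
  db_typed k D r A -> forall l D', k <= l -> db_typed l (D ++ D') r A.
Proof.
  induction 1; intros l D' Hl; eauto using db_typed.
  - constructor. rewrite nth_error_app1; auto.
    apply nth_error_Some. congruence.
  - constructor; eauto using type_at_le.
  - constructor. rewrite map_app. apply IHdb_typed. lia.
  - constructor; eauto using type_at_le.
Qed.

(** The replaced index is the outermost one, and [s] has no dangling index, so nothing is
    renumbered. Its type [A] is closed, hence unaffected by the shift under [Gen]. *)
Lemma db_typed_inst_term k D E A s r B :
  db_typed 0 [] s A -> db_typed k E r B -> E = D ++ [A] ->
  db_typed k D (inst_term (length D) s r) B.
Proof.
  intros Hs H. revert D. induction H; intros D' ->; simpl;
    eauto using db_typed.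
  - cases_index.
    + subst. rewrite nth_error_app2, Nat.sub_diag in H by lia.
      injection H as <-. apply (db_typed_weaken _ _ _ _ Hs k D'). lia.
    + constructor. assert (Hi : i < length (D' ++ [A]))
        by (apply nth_error_Some; congruence).
      rewrite length_app in Hi. simpl in Hi.
      rewrite nth_error_app1 in H by lia. assumption.
  - constructor. rewrite <- (length_map (lift 0)). apply IHdb_typed.
    rewrite map_app. simpl. now rewrite lift_is_type by
      (eapply db_typed_is_type; eauto).
Qed.

Lemma db_typed_close_term k D x A r B :
  db_typed k D r B -> is_type A ->
  db_typed k (D ++ [A]) (close_term (length D) x A r) B.
Proof.
  intros H HA. induction H; simpl; eauto using db_typed.
  - destruct var_eq_dec as [E|]; constructor; auto.
    injection E as <- <-. now rewrite nth_error_app2, Nat.sub_diag by lia.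
  - constructor. rewrite nth_error_app1; auto.
    apply nth_error_Some. congruence.
  - constructor. rewrite length_map in IHdb_typed.
    rewrite map_app. simpl. now rewrite lift_is_type.
Qed.

Lemma db_typed_inst_type k D m C r A :
  is_type C -> db_typed m D r A -> m = S k ->
  db_typed k (map (tinst k C) D) (inst_type k C r) (tinst k C A).
Proof.
  intros HC H. revert k. induction H; intros l ->; simpl in *;
    eauto using db_typed, tinst_equiv.
  - rewrite tinst_is_type by assumption. now constructor.
  - constructor. rewrite nth_error_map, H. reflexivity.
  - constructor; auto. apply tinst_at; auto. apply (type_at_le 0); auto; lia.
  - constructor. rewrite lift_is_type by assumption.
    replace (map (lift 0) (map (tinst l C) D))
      with (map (tinst (S l) C) (map (lift 0) D)); auto.
    rewrite !map_map. apply map_ext. intros B. symmetry.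
    now apply (lift_tinst 0).
  - rewrite (tinst_tinst 0 l C B A HC : tinst l C (tinst 0 B A) = _).
    constructor.
    + apply tinst_at; auto. apply (type_at_le 0); auto; lia.
    (* Under [TAll], [tinst] inserts [lift 0 C], which is [C] because [C] is closed. *)
    + rewrite <- (lift_is_type 0 C) at 3 by assumption. auto.
Qed.

(** The side condition leaves the annotations of free variables untouched, hence closed, as the
    variable rule demands. *)
Lemma db_typed_close_type k D X r A :
  db_typed k D r A -> (forall B, In B (Gamma r) -> ~ free_in_type X B) ->
  db_typed (S k) (map (close_type k X) D) (close_type_in_term k X r)
    (close_type k X A).
Proof.
  unfold Gamma. induction 1; intros HX; simpl in *;
    eauto using db_typed, close_type_equiv.
  - rewrite close_type_fresh by auto. now constructor.
  - constructor. rewrite nth_error_map, H. reflexivity.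
  - constructor; auto using close_type_at.
  - rewrite map_app in HX. econstructor; [apply IHdb_typed1 | apply IHdb_typed2];
      intros; apply HX, in_app_iff; auto.
  - rewrite map_app in HX. econstructor; [apply IHdb_typed1 | apply IHdb_typed2];
      intros; apply HX, in_app_iff; auto.
  - constructor.
    replace (map (lift 0) (map (close_type k X) D))
      with (map (close_type (S k) X) (map (lift 0) D)); auto.
    rewrite !map_map. apply map_ext. intros B. symmetry.
    now apply (lift_close_type 0).
  - rewrite (close_type_tinst 0 k X B A : close_type k X (tinst 0 B A) = _).
    constructor; auto using close_type_at.
Qed.

(** * Agreement of the two typing judgements *)

Lemma Gamma_is_type k D r A B : db_typed k D r A -> In B (Gamma r) -> is_type B.
Proof.
  unfold Gamma. induction 1; simpl; try tauto;
    rewrite ?map_app, ?in_app_iff; intuition congruence.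
Qed.

(** This recovers the side condition on type abstraction: an annotation mentioning [X] would acquire
    a dangling index when [X] is closed. *)
Lemma Gamma_close_type_not_free k X r :
  (forall B, In B (Gamma (close_type_in_term k X r)) -> is_type B) ->
  forall B, In B (Gamma r) -> ~ free_in_type X B.
Proof.
  unfold Gamma. revert k. induction r; simpl; intros m H B HB; eauto.
  - destruct HB as [<-|[]]. apply (close_type_not_free 0 m); [|lia].
    apply H. now left.
  - rewrite map_app in *. apply in_app_iff in HB as [HB|HB];
      [eapply IHr1 | eapply IHr2]; eauto; intros; apply H, in_app_iff; eauto.
  - rewrite map_app in *. apply in_app_iff in HB as [HB|HB];
      [eapply IHr1 | eapply IHr2]; eauto; intros; apply H, in_app_iff; eauto.
Qed.

Lemma typed_db r A : typed r A -> db_typed 0 [] r A.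
Proof.
  induction 1; eauto using db_typed.
  - constructor; auto. now apply (db_typed_close_term 0 []).
  - constructor. now apply (db_typed_close_type 0 []).
  - rewrite <- (tinst_close_type 0) by assumption. now constructor.
Qed.

(** A measure unchanged by opening a binder with a name, since variables and indices weigh the
    same. *)
Fixpoint size (r : term) : nat :=
  match r with
  | Var _ _ | Bound _ => 0
  | Lam _ r | Proj _ r | Gen r | Inst r _ => S (size r)
  | App r s | Plus r s => S (size r + size s)
  end.

Lemma size_inst_type k C r : size (inst_type k C r) = size r.
Proof. revert k. induction r; simpl; auto. Qed.

Lemma size_inst_term k x A r : size (inst_term k (Var x A) r) = size r.
Proof. revert k. induction r; simpl; auto. intros j. now cases_index. Qed.

(** The body of a binder must first be opened with a fresh name, which does not give a
    subderivation; hence the outer induction on size. Conversion keeps the term, so an inner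
    induction on the derivation handles it. *)
Lemma db_typed_typed r A : db_typed 0 [] r A -> typed r A.
Proof.
  remember (size r) as n eqn:Hn. revert r A Hn.
  induction n as [n IHn] using lt_wf_ind. intros r A -> H.
  assert (IH : forall t B, size t < size r -> db_typed 0 [] t B -> typed t B)
    by (intros; eapply IHn; eauto).
  clear IHn. remember 0 as k eqn:Hk. remember [] as D eqn:HD.
  induction H; subst; simpl in IH.
  - now constructor.
  - now destruct i.
  - eapply typed_equiv; eauto.
  - destruct (close_inst_term_fresh A r) as [N HN].
    assert (Hr := db_typed_at _ _ _ _ H0 (Forall_cons _ H (Forall_nil _))).
    rewrite <- (HN N 0 0) by (auto; apply Hr).
    change (typed (lam_named N A (inst_term 0 (Var N A) r)) (Arr A B)).
    constructor; [assumption|]. apply IH; [rewrite size_inst_term; lia|].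
    apply (db_typed_inst_term 0 [] [A] A); auto. now constructor.
  - eapply typed_app; apply IH; eauto; lia.
  - apply typed_plus; apply IH; auto; lia.
  - eapply typed_proj, IH; eauto.
  - destruct (close_inst_type_fresh r) as [N1 HN1].
    destruct (close_type_tinst_fresh A) as [N2 HN2].
    (* One name fresh for both the body and its type, so that closing it restores both. *)
    set (X := max N1 N2).
    destruct (db_typed_at _ _ _ _ H (Forall_nil _)) as [Hr HA].
    assert (Er := HN1 X 0 0 ltac:(lia) Hr).
    rewrite <- (HN2 X 0 ltac:(lia) HA), <- Er.
    change (typed (gen_named X (inst_type 0 (TVar X) r))
              (all_named X (tinst 0 (TVar X) A))).
    constructor.
    + apply IH; [rewrite size_inst_type; lia|].
      now apply (db_typed_inst_type 0 [] 1).
    + apply (Gamma_close_type_not_free 0). rewrite Er.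
      intros B. eapply Gamma_is_type; eauto.
  - destruct (close_type_tinst_fresh A) as [N HN].
    destruct (db_typed_at _ _ _ _ H0 (Forall_nil _)) as [Hr HA].
    assert (EA := HN N 0 (le_n _) HA).
    assert (HA' : is_type (tinst 0 (TVar N) A)) by (now apply tinst_at).
    (* The named rule substitutes for a named variable, so [A] is rewritten as the closure of its
       opening with [N]. *)
    rewrite <- EA, (tinst_close_type 0) by assumption.
    constructor; auto. apply IH; [lia|]. unfold all_named. now rewrite EA.
Qed.

Lemma typed_iff_db r A : typed r A <-> db_typed 0 [] r A.
Proof. split; [apply typed_db | apply db_typed_typed]. Qed.

(** * Subject reduction *)

Lemma free_vars_close_term k x A r v :
  In v (free_vars (close_term k x A r)) <->
  In v (free_vars r) /\ v <> (x, A).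
Proof.
  revert k. induction r; simpl; intros m; try tauto; auto.
  - destruct var_eq_dec as [E|E]; simpl; intuition congruence.
  - rewrite !in_app_iff, IHr1, IHr2. tauto.
  - rewrite !in_app_iff, IHr1, IHr2. tauto.
Qed.

Lemma free_vars_close_type k X r :
  (forall B, In B (Gamma r) -> ~ free_in_type X B) ->
  free_vars (close_type_in_term k X r) = free_vars r.
Proof.
  unfold Gamma. revert k. induction r; simpl; intros m H; auto.
  - now rewrite close_type_fresh by auto.
  - rewrite map_app in H. f_equal; [apply IHr1 | apply IHr2]; intros;
      apply H, in_app_iff; auto.
  - rewrite map_app in H. f_equal; [apply IHr1 | apply IHr2]; intros;
      apply H, in_app_iff; auto.
Qed.

Lemma free_vars_inst_type k C r :
  (forall B, In B (Gamma r) -> is_type B) ->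
  free_vars (inst_type k C r) = free_vars r.
Proof.
  unfold Gamma. revert k. induction r; simpl; intros m H; auto.
  - now rewrite tinst_is_type by auto.
  - rewrite map_app in H. f_equal; [apply IHr1 | apply IHr2]; intros;
      apply H, in_app_iff; auto.
  - rewrite map_app in H. f_equal; [apply IHr1 | apply IHr2]; intros;
      apply H, in_app_iff; auto.
Qed.

Lemma free_vars_inst_term k s r :
  incl (free_vars (inst_term k s r)) (free_vars r ++ free_vars s).
Proof.
  intros v. rewrite in_app_iff. revert k.
  induction r; simpl; intros m; rewrite ?in_app_iff; eauto.
  - cases_index; simpl; tauto.
  - specialize (IHr1 m). specialize (IHr2 m). tauto.
  - specialize (IHr1 m). specialize (IHr2 m). tauto.
Qed.

(** * Preservation by the individual rules *)

Lemma db_typed_beta A r s T :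
  db_typed 0 [] (App (Lam A r) s) T -> db_typed 0 [] (inst_term 0 s r) T.
Proof.
  intros H. apply db_typed_inv in H as (D & Hl & Hs).
  apply db_typed_inv in Hl as (B & HA & Hr & E).
  apply Arr_inj in E as [ED EB].
  apply (db_equiv _ _ _ B); [|assumption].
  apply (db_typed_inst_term 0 [] [A] A); auto.
  eapply db_equiv; [eassumption | now symmetry].
Qed.

Lemma db_typed_type_beta r C T :
  db_typed 0 [] (Inst (Gen r) C) T -> db_typed 0 [] (inst_type 0 C r) T.
Proof.
  intros H. apply db_typed_inv in H as (A & HC & Hg & E).
  apply db_typed_inv in Hg as (B & Hr & EB). apply TAll_inj in EB.
  apply (db_equiv _ _ _ (tinst 0 C B)).
  - now apply (db_typed_inst_type 0 [] 1).
  - transitivity (tinst 0 C A); [now apply tinst_equiv | assumption].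
Qed.

(** The inclusion strengthens the induction over contexts: it carries the side condition on [X] from
    [r] to [s] under a type abstraction. *)
Definition preserves (R : term -> term -> Prop) : Prop :=
  forall r s A, R r s -> db_typed 0 [] r A ->
  db_typed 0 [] s A /\ incl (free_vars s) (free_vars r).

Lemma red_rule_preserves : preserves red_rule.
Proof.
  intros r s T [x A r' s' HA Hr Hs|X r' C Hr HC|r' s' A Hr Hs] H.
  - rewrite <- (inst_term_close 0 0 x A s' r') by assumption. split.
    + now apply (db_typed_beta A).
    + simpl. intros v Hv. apply free_vars_inst_term in Hv.
      assumption.
  - rewrite <- (inst_type_close 0 0) by assumption. split.
    + now apply db_typed_type_beta.
    + apply db_typed_inv in H as (A & _ & Hg & _).
      simpl. rewrite free_vars_inst_type; [apply incl_refl|].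
      intros B. exact (Gamma_is_type _ _ _ _ _ Hg).
  - apply db_typed_inv in H as (B & HP & E). split.
    (* The premise of the projection rule types the selected component; inversion on the sum would
       not say which component has type [A]. *)
    + apply (db_equiv _ _ _ A); [now apply typed_db | assumption].
    + simpl. apply incl_appl, incl_refl.
Qed.

Ltac incl_free_vars := intros v; simpl; rewrite ?in_app_iff; tauto.

Lemma sym_rule_preserves : preserves sym_rule.
Proof.
  intros r s T H HT.
  destruct H as [r s Hr Hs|r s t Hr Hs Ht|r s t Hr Hs Ht|x A r s HA Hr Hs
                |r s A B C Hr Hs]; (split; [|incl_free_vars]).
  - apply db_typed_inv in HT as (A & B & H1 & H2 & E).
    eapply db_equiv; [apply db_plus; eassumption|].
    now rewrite equiv_comm.
  - apply db_typed_inv in HT as (A & B & H1 & H2 & E).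
    apply db_typed_inv in H1 as (A1 & A2 & H3 & H4 & E').
    eapply db_equiv; [repeat apply db_plus; eassumption|].
    now rewrite <- equiv_assoc, E'.
  - apply db_typed_inv in HT as (D & H1 & H2).
    apply db_typed_inv in H1 as (A & B & H3 & H4 & E).
    (* The sum has a conjunction type yet is applied, so both summands are functions with domain
       [D]. *)
    apply And_equiv_Arr in E as (T1 & T2 & ET & EA & EB).
    apply (db_equiv _ _ _ (And T1 T2)); [|now symmetry].
    apply db_plus; apply db_app with D; eauto using db_equiv.
  - apply db_typed_inv in HT as (B & _ & H1 & E).
    apply db_typed_inv in H1 as (B1 & B2 & H3 & H4 & EB).
    eapply db_equiv; [apply db_plus; apply db_lam; eassumption|].
    now rewrite <- equiv_dist, EB.
  - apply typed_db in Hr. apply db_typed_inv in HT as (D & H1 & H2).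
    apply db_typed_inv in H1 as (E & _ & EA).
    apply Arr_inj in EA as [ED EB].
    apply (db_equiv _ _ _ B); [|assumption]. apply db_proj with C.
    apply db_app with A; [assumption|].
    eapply db_equiv; [eassumption | now symmetry].
Qed.

Lemma sym_rule_converse_preserves : preserves (fun r s => sym_rule s r).
Proof.
  intros r s T H HT.
  destruct H as [r s Hr Hs|r s t Hr Hs Ht|r s t Hr Hs Ht|x A r s HA Hr Hs
                |r s A B C Hr Hs]; (split; [|incl_free_vars]).
  - apply db_typed_inv in HT as (A & B & H1 & H2 & E).
    eapply db_equiv; [apply db_plus; eassumption|].
    now rewrite equiv_comm.
  - apply db_typed_inv in HT as (A & B & H1 & H2 & E).
    apply db_typed_inv in H2 as (A1 & A2 & H3 & H4 & E').
    eapply db_equiv; [repeat apply db_plus; eassumption|].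
    now rewrite equiv_assoc, E'.
  - apply db_typed_inv in HT as (T1 & T2 & H1 & H2 & E).
    apply db_typed_inv in H1 as (D1 & H3 & H4).
    apply db_typed_inv in H2 as (D2 & H5 & H6).
    (* The two copies of [t] are typed independently; uniqueness identifies the domains of the two
       functions. *)
    assert (ED := db_typed_unique _ _ _ _ _ H6 H4).
    apply (db_equiv _ _ _ (And T1 T2)); [|assumption].
    apply db_app with D1; [|assumption].
    eapply db_equiv; [apply db_plus; eassumption|].
    now rewrite ED, equiv_dist.
  - apply db_typed_inv in HT as (T1 & T2 & H1 & H2 & E).
    apply db_typed_inv in H1 as (B1 & HA' & H3 & E1).
    apply db_typed_inv in H2 as (B2 & _ & H4 & E2).
    eapply db_equiv; [apply db_lam; [|apply db_plus]; eassumption|].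
    now rewrite equiv_dist, E1, E2.
  - apply typed_db in Hr. apply db_typed_inv in HT as (D & H1 & E).
    apply db_typed_inv in H1 as (A' & H3 & H4).
    (* Uniqueness reconciles the type found by inversion with the one required by the rule, giving
       the type of the argument. *)
    assert (EA := db_typed_unique _ _ _ _ _ H3 Hr).
    apply Arr_inj in EA as [EA _].
    apply (db_equiv _ _ _ B); [|assumption].
    apply db_app with A; [|now apply db_equiv with A'].
    apply db_proj with (Arr A C).
    eapply db_equiv; [exact Hr | apply equiv_dist].
Qed.

Lemma sym_rule2_preserves : preserves sym_rule2.
Proof.
  intros r s A [H|H];
    [apply sym_rule_preserves | apply sym_rule_converse_preserves]; assumption.
Qed.

(** * Closure under contexts *)

Lemma red_rule_left_term r s : red_rule r s -> is_term r.
Proof.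
  intros [x A t u HA Ht Hu|X t A Ht HA|t u A Ht Hu].
  - split; [now apply lam_named_is_term | assumption].
  - split; [now apply gen_named_is_term | assumption].
  - apply typed_db in Ht. split; [eapply db_typed_is_type; eauto|].
    split; [eapply db_typed_is_term; eauto | assumption].
Qed.

Lemma sym_rule_terms r s : sym_rule r s -> is_term r /\ is_term s.
Proof.
  assert (HL := lam_named_is_term).
  intros [t u Ht Hu|t u v Ht Hu Hv|t u v Ht Hu Hv|x A t u HA Ht Hu
         |t u A B C Ht Hu]; try (unfold is_term in *; simpl in *; tauto).
  - split; [|split]; apply HL; auto. split; assumption.
  - apply typed_db in Ht. assert (HT := db_typed_is_type _ _ Ht).
    apply db_typed_is_term in Ht.
    unfold is_type, is_term in *; simpl in *; tauto.
Qed.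

(** Opening a closed body gives back that body only for terms without dangling indices, which this
    guarantees under binders. *)
Lemma contextual_left_term R :
  (forall r s, R r s -> is_term r) ->
  forall r s, contextual R r s -> is_term r.
Proof.
  intros HR r s H. induction H; eauto using lam_named_is_term,
    gen_named_is_term; try (split; assumption).
Qed.

Lemma contextual_preserves R :
  (forall r s, R r s -> is_term r) -> preserves R -> preserves (contextual R).
Proof.
  intros HR HP r s T H. revert T.
  induction H; intros T HT.
  - now apply HP.
  - apply (contextual_left_term _ HR) in H0 as Hr.
    apply db_typed_inv in HT as (B & _ & H1 & E).
    destruct (IHcontextual B) as [IH1 IH2].
    (* The body [r] is seen as its own closure reopened with [x], and so inherits a typing from the
       body of the abstraction. *)
    + rewrite <- (subst_term_self x A r), <- (inst_term_close 0 0)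
        by assumption.
      apply (db_typed_inst_term 0 [] [A] A); auto. now constructor.
    + split.
      * apply (db_equiv _ _ _ (Arr A B)); [|assumption].
        constructor; [assumption|]. now apply (db_typed_close_term 0 []).
      * intros v Hv. simpl in *. rewrite free_vars_close_term in *.
        split; [now apply IH2 | apply Hv].
  - apply db_typed_inv in HT as (A & H1 & H2).
    destruct (IHcontextual _ H1). split; [eauto using db_typed|].
    simpl. now apply incl_app_app, incl_refl.
  - apply db_typed_inv in HT as (A & H1 & H2).
    destruct (IHcontextual _ H2). split; [eauto using db_typed|].
    simpl. apply incl_app_app; [apply incl_refl | assumption].
  - apply db_typed_inv in HT as (A & B & H1 & H2 & E).
    destruct (IHcontextual _ H1). split; [eauto using db_typed|].
    simpl. now apply incl_app_app, incl_refl.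
  - apply db_typed_inv in HT as (A & B & H1 & H2 & E).
    destruct (IHcontextual _ H2). split; [eauto using db_typed|].
    simpl. apply incl_app_app; [apply incl_refl | assumption].
  - apply db_typed_inv in HT as (B & H1 & E).
    destruct (IHcontextual _ H1). split; [eauto using db_typed | assumption].
  - apply (contextual_left_term _ HR) in H as Hr.
    apply db_typed_inv in HT as (B & H1 & E).
    (* The congruence rule does not ask for this; it follows from the typing of [gen_named X r]. *)
    assert (HX : forall C, In C (Gamma r) -> ~ free_in_type X C).
    { apply (Gamma_close_type_not_free 0). intros C.
      eapply Gamma_is_type; eauto. }
    assert (HrB : db_typed 0 [] r (tinst 0 (TVar X) B)).
    { rewrite <- (subst_type_in_term_self X r), <- (inst_type_close 0 0)
        by easy.
      now apply (db_typed_inst_type 0 [] 1). }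
    destruct (IHcontextual _ HrB) as [IH1 IH2].
    assert (HXs : forall C, In C (Gamma s) -> ~ free_in_type X C).
    { intros C HC. apply HX. unfold Gamma in *.
      eapply incl_map; eassumption. }
    split; [|simpl; now rewrite !free_vars_close_type].
    apply (db_typed_close_type 0 [] X) in IH1; [|assumption].
    apply (db_equiv _ _ _ (TAll (close_type 0 X (tinst 0 (TVar X) B))));
      [exact (db_gen 0 [] _ _ IH1)|].
    rewrite <- E. apply equiv_all.
    (* Closing undoes the opening of [B] only when [X] is not free in [B];
       comparing two types of [r] avoids having to know it. *)
    apply (db_typed_unique (close_type_in_term 0 X r) 1 []); [|assumption].
    now apply (db_typed_close_type 0 []).
  - apply db_typed_inv in HT as (B & HA & H1 & E).
    destruct (IHcontextual _ H1). split; [eauto using db_typed | assumption].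
Qed.

Theorem theorem3 (r s : term) (A : type) :
  red r s \/ sym r s -> typed r A -> typed s A.
Proof.
  rewrite !typed_iff_db. intros [H|H] HA.
  - apply (contextual_preserves red_rule) with r; auto.
    + exact red_rule_left_term.
    + exact red_rule_preserves.
  - apply (contextual_preserves sym_rule2) with r; auto.
    + intros t u [Ht|Ht]; now apply sym_rule_terms in Ht.
    + exact sym_rule2_preserves.
Qed.
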